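(* Let $n\ge 1$. As $\rho$ ranges over all pure Gaussian states of $n$ modes, the set of all possible vectors of entanglement entropies of single modes with respect to the rest of the system, $$\left(E_{1|\{2,\dots,n\}},\dots,E_{n|\{1,\dots,n-1\}}\right),$$ is equal to $$\Bigl\{(s(c_1),\dots,s(c_n)):\ c_j\ge 1\ \text{ and }\ c_j-1\le\sum_{k\ne j}(c_k-1)\ \text{ for all } j=1,\dots,n\Bigr\}.$$
   Context: For $n$ bosonic modes with canonical coordinates $R=(x_1,p_1,\dots,x_n,p_n)$, $[R_j,R_k]=i\sigma_{jk}$, $\sigma=\bigoplus_{k=1}^n\begin{pmatrix}0&1\\-1&0\end{pmatrix}$, a Gaussian state $\rho$ is a quantum state with Gaussian characteristic function; it is determined by its first moments $\mu_j=\mathrm{tr}(\rho R_j)$ and its real symmetric $2n\times 2n$ covariance matrix $\gamma_{jk}=\mathrm{tr}(\rho\{R_j-\mu_j,R_k-\mu_k\})$ (so the vacuum has $\gamma=\mathbb{1}$). The covariance matrices of Gaussian states are exactly the real symmetric matrices with $\gamma+i\sigma\ge 0$. A Gaussian state is pure if and only if all its symplectic eigenvalues equal $1$, i.e. $S\gamma S^T=\mathbb{1}$ for some real $S$ with $S\sigma S^T=\sigma$. The reduced state $\rho_j$ to the $j$-th mode is the Gaussian state whose covariance matrix is the $j$-th $2\times2$ main diagonal block $\gamma_j$ of $\gamma$ (rows and columns $2j-1,2j$); its symplectic eigenvalue is $c_j=\sqrt{\det\gamma_j}\ge1$. The entanglement entropy of mode $j$ with respect to the rest of the system is the von Neumann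 entropy of $\rho_j$, which equals $$E_{j|\{1,\dots,n\}\setminus\{j\}}:=S(\rho_j)=s(c_j),\qquad s(c):=\frac{c+1}{2}\log_2\frac{c+1}{2}-\frac{c-1}{2}\log_2\frac{c-1}{2},$$ for $s:[1,\infty)\to[0,\infty)$, with the convention $0\log_2 0=0$. Empty sums are $0$. *)

(* Defs.v *)
From HB Require Import structures.
From mathcomp Require Export all_boot all_order all_algebra complex.
From mathcomp Require Export all_classical all_reals all_analysis.

Set Implicit Arguments.
Unset Strict Implicit.
Unset Printing Implicit Defensive.

Import Order.TTheory GRing.Theory Num.Theory.
Local Open Scope sesquilinear_scope.
Local Open Scope ring_scope.

(* Phase space of n modes, kept in the form of a direct sum of n planes: block
   k is spanned by (x_k, p_k), so [submxblock A j j] consists of the rows and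
   columns 2j-1, 2j of A. *)
Notation phase_dim n := (\sum_(k < n) 2)%N.

Section Phase.
Variable R : realType.

Definition sigma1 : 'M[R]_2 :=
  \matrix_(i, j) (((i == 0) && (j == 1))%:R - ((i == 1) && (j == 0))%:R).

Definition sigma n : 'M[R]_(phase_dim n) := \mxdiag_(k < n) sigma1.

Definition psdmx m (M : 'M[R[i]]_m) : Prop :=
  M \is hermsymmx /\ forall v : 'rV[R[i]]_m, 0 <= (v *m M *m v ^t*) 0 0.

Definition toC m n (A : 'M[R]_(m, n)) : 'M[R[i]]_(m, n) :=
  map_mx (real_complex R) A.

(* Gaussian states in phase-space form: such a state is determined by its
   first and second moments, and the admissible covariance matrices are the
   real symmetric ones obeying the uncertainty relation. The normalisation is
   the one in which the vacuum has covariance matrix 1. *)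
Record gaussian_state n := GaussianState {
  mean : 'cV[R]_(phase_dim n);
  cov : 'M[R]_(phase_dim n);
  cov_sym : cov^T = cov;
  cov_uncertainty : psdmx (toC cov + 'i%C *: toC (sigma n))
}.

Definition symplectic n (S : 'M[R]_(phase_dim n)) : Prop :=
  S *m sigma n *m S^T = sigma n.

(* All symplectic eigenvalues of the covariance matrix are 1. *)
Definition pure n (rho : gaussian_state n) : Prop :=
  exists2 S, symplectic S & S *m cov rho *m S^T = 1%:M.

Definition reduced_cov n (j : 'I_n) (A : 'M[R]_(phase_dim n)) :
    'M[R]_(phase_dim 1) :=
  \mxblock_(a < 1, b < 1) submxblock A j j.

Let proj n (j : 'I_n) : 'M[R]_(phase_dim 1, phase_dim n) :=
  \mxblock_(a < 1, k < n) (if k == j then 1%:M else 0 : 'M[R]_2).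

Let tr_proj n (j : 'I_n) :
  (proj j)^T = \mxblock_(k < n, a < 1) (if k == j then 1%:M else 0 : 'M[R]_2).
Proof.
rewrite tr_mxblock; apply/eq_mxblock => k a.
by case: (k == j); rewrite ?trmx1 ?trmx0.
Qed.

Let reduced_covE n (j : 'I_n) A : reduced_cov j A = proj j *m A *m (proj j)^T.
Proof.
rewrite tr_proj -[in RHS](submxblockK A) !mul_mxblock.
apply/eq_mxblock => a b.
rewrite (big_only1 j) // => [|k kj _]; last by rewrite (negPf kj) mulmx0.
rewrite (big_only1 j) // => [|k kj _]; last by rewrite (negPf kj) mul0mx.
by rewrite eqxx mulmx1 mul1mx.
Qed.

Let reduced_sigma n (j : 'I_n) : reduced_cov j (sigma n) = sigma 1.
Proof.
apply/eq_mxblock => a b; rewrite submxblock_diag !ord1 eqxx.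
by rewrite conform_mx_id.
Qed.

Fact reduced_cov_sym n (j : 'I_n) (rho : gaussian_state n) :
  (reduced_cov j (cov rho))^T = reduced_cov j (cov rho).
Proof.
by rewrite tr_mxblock; apply/eq_mxblock => a b; rewrite tr_submxblock cov_sym.
Qed.

Let toC_conj m n (A : 'M[R]_(m, n)) : map_mx Num.conj (toC A) = toC A.
Proof. by apply/matrixP => a b; rewrite !mxE; exact: conjc_real. Qed.

Let psdmx_congr m p (P : 'M[R]_(m, p)) M :
  psdmx M -> psdmx (toC P *m M *m toC P^T).
Proof.
move=> [/is_hermitianmxP hM pM]; split.
  apply/is_hermitianmxP; move: hM; rewrite expr0 !scale1r => hM.
  rewrite [in LHS]hM !trmx_mul !map_mxM /= mulmxA.
  have -> : (toC P^T)^T = toC P by rewrite /toC map_trmx trmxK.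
  have -> : (toC P)^T = toC P^T by rewrite /toC map_trmx.
  by rewrite !toC_conj.
move=> v; have := pM (v *m toC P).
have -> : (v *m toC P) ^t* = toC P^T *m v ^t*.
  by rewrite trmx_mul map_mxM /= [(toC P)^T]map_trmx toC_conj.
by rewrite !mulmxA.
Qed.

Fact reduced_cov_uncertainty n (j : 'I_n) (rho : gaussian_state n) :
  psdmx (toC (reduced_cov j (cov rho)) + 'i%C *: toC (sigma 1)).
Proof.
have := psdmx_congr (proj j) (cov_uncertainty rho).
rewrite mulmxDr mulmxDl -scalemxAr -scalemxAl.
by rewrite /toC -!map_mxM -!reduced_covE reduced_sigma.
Qed.

Definition reduced_state n (j : 'I_n) (rho : gaussian_state n) :
    gaussian_state 1 :=
  @GaussianState 1 (\mxcol_(a < 1) submxcol (mean rho) j)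
    (reduced_cov j (cov rho)) (reduced_cov_sym j rho)
    (reduced_cov_uncertainty j rho).

Definition symp_eigenvalue (rho : gaussian_state 1) : R :=
  Num.sqrt (\det (cov rho)).

Fact symp_eigenvalue_reduced n (j : 'I_n) (rho : gaussian_state n) :
  symp_eigenvalue (reduced_state j rho) =
  Num.sqrt (\det (submxblock (cov rho) j j)).
Proof.
rewrite /symp_eigenvalue /= /reduced_cov; move: (submxblock _ _ _) => B.
have e : phase_dim 1 = 2%N by rewrite big_ord1.
have detC m p (E : m = p) (A : 'M[R]_m) : \det A = \det (castmx (E, E) A).
  by case: p / E.
rewrite (detC _ _ e); congr (Num.sqrt (\det _)).
rewrite -[in RHS](@mxblockK _ 1 1 (fun=> 2%N) (fun=> 2%N)
  (fun _ _ => B) ord0 ord0).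
apply/matrixP => a b; rewrite castmxE /submxblock [RHS]mxE.
by congr (_ _ _); apply: ord_inj;
  apply/esym; rewrite [LHS]tagnat.RankEsum big_pred0.
Qed.

Definition log2 (x : R) : R := ln x / ln 2.

(* Only meaningful for c >= 1; the convention 0 log2 0 = 0 is automatic. *)
Definition entropyf (c : R) : R :=
  (c + 1) / 2 * log2 ((c + 1) / 2) - (c - 1) / 2 * log2 ((c - 1) / 2).

(* Von Neumann entropy of a one-mode Gaussian state, through the closed
   formula in its symplectic eigenvalue. *)
Definition vn_entropy (rho : gaussian_state 1) : R := entropyf (symp_eigenvalue rho).

Definition entanglement_entropy n (rho : gaussian_state n) (j : 'I_n) : R :=
  vn_entropy (reduced_state j rho).

End Phase.

(* Main.v *)
Require Import Defs.
From mathcomp Require Import ring lra.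

Set Implicit Arguments.
Unset Strict Implicit.
Unset Printing Implicit Defensive.

Import Order.TTheory GRing.Theory Num.Theory.
Local Open Scope sesquilinear_scope.
Local Open Scope ring_scope.

(** Necessity. A pure covariance matrix is [g = T T^T] with [T] symplectic. The
    [(j, j)] block of [g sigma g = sigma] reads [\sum_k \det g_jk = 1], that is,
    [c_j ^ 2 - 1 = \sum_(k != j) - \det g_jk], and positivity of [g + i sigma] on
    modes [j], [k] gives [- \det g_jk <= (c_j + 1) (c_k - 1)]; divide by
    [c_j + 1].

    Sufficiency. A real matrix [L] acting on positions, with [K = L^-T] acting on
    momenta, gives a pure state with [c_j ^ 2 = (L L^T)_jj (K K^T)_jj]. For three
    modes, two squeezers and a beam splitter reach every admissible triple. For
    more modes, split the modes other than the one with the largest [c_j - 1] into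
    two balanced nonempty parts; the three sums of [c_j - 1] satisfy the triangle
    inequalities, and beam splitters with vacuum distribute each of the three
    modes over its part, since splitting the covariance [(1 + M) 1] with weights
    [m_j / M] yields the blocks [(1 + m_j) 1]. *)

(** * The symplectic form *)

Lemma ord2_ind (P : 'I_2 -> Prop) : P 0 -> P 1 -> forall i, P i.
Proof.
move=> P0 P1 [[|[|i]] hi] //.
- by rewrite (_ : Ordinal hi = 0) //; apply/val_inj.
- by rewrite (_ : Ordinal hi = 1) //; apply/val_inj.
Qed.

Lemma mulmx2E (K : pzSemiRingType) m p (A : 'M[K]_(m, 2)) (B : 'M[K]_(2, p)) i j :
  (A *m B) i j = A i 0 * B 0 j + A i 1 * B 1 j.
Proof.
by rewrite mxE big_ord_recl big_ord1 (_ : lift 0 0 = 1) //; apply/val_inj.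
Qed.

Lemma det_mx22 (K : comPzRingType) (A : 'M[K]_2) :
  \det A = A 0 0 * A 1 1 - A 0 1 * A 1 0.
Proof.
rewrite (expand_det_row A 0) big_ord_recl big_ord1.
rewrite (_ : lift 0 0 = 1); last exact/val_inj.
rewrite /cofactor !det_mx11 !mxE /= expr0 expr1 mul1r mulN1r mulrN.
by congr (_ * A _ _ - _ * A _ _); apply/val_inj.
Qed.

Section SymplecticForm.
Variable R : realType.

Lemma sigma1E : ((@sigma1 R 0 0 = 0) * (@sigma1 R 0 1 = 1)) *
                ((@sigma1 R 1 0 = -1) * (@sigma1 R 1 1 = 0)).
Proof. by rewrite !mxE /= ?subr0 ?sub0r. Qed.

Lemma sigma1_tr : (sigma1 R)^T = - sigma1 R.
Proof.
by apply/matrixP; elim/ord2_ind; elim/ord2_ind;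
  rewrite !mxE /= ?subr0 ?sub0r ?opprK ?oppr0.
Qed.

Lemma sigma1_sqr : sigma1 R *m sigma1 R = -1%:M.
Proof.
apply/matrixP; elim/ord2_ind; elim/ord2_ind;
  rewrite mulmx2E !sigma1E !mxE /=; ring.
Qed.

(** On a plane the symplectic form is the area form, which a congruence multiplies by the
    determinant. Hence determinant one means symplectic for a single mode, and determinants of
    blocks can be read off products with [sigma1]. *)
Lemma sigma1_congr (C : 'M[R]_2) : C *m sigma1 R *m C^T = (\det C)%:M *m sigma1 R.
Proof.
rewrite det_mx22; apply/matrixP; elim/ord2_ind; elim/ord2_ind;
  rewrite mul_scalar_mx !mulmx2E !mxE /=; ring.
Qed.

Lemma sigma_block n :
  sigma R n = \mxblock_(j < n, k < n) (if j == k then sigma1 R else 0).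
Proof. by apply/eq_mxblock => j k; rewrite conform_mx_id. Qed.

Lemma sigma_tr n : (sigma R n)^T = - sigma R n.
Proof. by rewrite tr_mxdiag -mxdiagN; apply/eq_mxdiag => i; exact: sigma1_tr. Qed.

Lemma sigma_sqr n : sigma R n *m sigma R n = -1%:M.
Proof.
rewrite mul_mxblock_mxdiag.
transitivity (\mxdiag_(k < n) (- 1%:M : 'M[R]_2)).
  apply/eq_mxblock => i j; case: eqP => // _; last by rewrite mul0mx.
  by rewrite !conform_mx_id; exact: sigma1_sqr.
by rewrite mxdiagN (mxdiagZ (p_ := fun=> 2%N)).
Qed.

End SymplecticForm.

(** * Necessity *)

Definition dotmx (R : realType) N (x y : 'rV[R]_N) : R := (x *m y^T) 0 0.

Section DotProduct.
Variables (R : realType) (N : nat).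
Implicit Types x y z : 'rV[R]_N.

Lemma dotmxC x y : dotmx x y = dotmx y x.
Proof. by rewrite /dotmx -[x *m _]trmxK trmx_mul trmxK mxE. Qed.

Lemma dotmxDl x y z : dotmx (x + y) z = dotmx x z + dotmx y z.
Proof. by rewrite /dotmx mulmxDl mxE. Qed.

Lemma dotmxZl a x z : dotmx (a *: x) z = a * dotmx x z.
Proof. by rewrite /dotmx -scalemxAl mxE. Qed.

Lemma dotmxDr x y z : dotmx z (x + y) = dotmx z x + dotmx z y.
Proof. by rewrite dotmxC dotmxDl !(dotmxC z). Qed.

Lemma dotmxZr a x z : dotmx z (a *: x) = a * dotmx z x.
Proof. by rewrite dotmxC dotmxZl (dotmxC z). Qed.

Lemma dotmx_sum x : dotmx x x = \sum_k x 0 k ^+ 2.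
Proof. by rewrite /dotmx mxE; apply: eq_bigr => k _; rewrite mxE expr2. Qed.

Lemma dotmx_ge0 x : 0 <= dotmx x x.
Proof. by rewrite dotmx_sum sumr_ge0 // => k _; exact: sqr_ge0. Qed.

Lemma dotmx_eq0 x : (dotmx x x == 0) = (x == 0).
Proof.
apply/idP/idP => [|/eqP ->]; last by rewrite /dotmx mul0mx mxE.
rewrite dotmx_sum psumr_eq0 => [|k _]; last exact: sqr_ge0.
move=> /allP h; apply/eqP/rowP => k; rewrite mxE.
by apply/eqP; rewrite -sqrf_eq0; apply: h; rewrite mem_index_enum.
Qed.

Lemma mulmx_trE m p (A : 'M[R]_(m, N)) (B : 'M[R]_(p, N)) i j :
  (A *m B^T) i j = dotmx (row i A) (row j B).
Proof. by rewrite /dotmx !mxE; apply: eq_bigr => k _; rewrite !mxE. Qed.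

(* Bessel's inequality for the orthogonal pair q, q' of equal norms. *)
Lemma bessel2 (p q q' : 'rV[R]_N) : dotmx q q' = 0 -> dotmx q' q' = dotmx q q ->
  0 < dotmx p p ->
  dotmx p q ^+ 2 + dotmx p q' ^+ 2 <= dotmx p p * dotmx q q.
Proof.
move=> qq' q'q' p0.
set s := dotmx p q; set t := dotmx p q'; set D := s ^+ 2 + t ^+ 2.
(* With [P] and [r] the squared norms of [p] and [q], the squared norm of this vector is
   [P * D * (P * r - D)], which would be negative if [D > P * r]. *)
have := dotmx_ge0 (dotmx p p *: (s *: q + t *: q') + (- D) *: p).
rewrite !(dotmxDl, dotmxDr, dotmxZl, dotmxZr).
rewrite (dotmxC q p) (dotmxC q' p) (dotmxC q' q) qq' q'q' -/s -/t.
have : 0 <= dotmx q q by exact: dotmx_ge0.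
move: (dotmx p p) (dotmx q q) p0 => P r P0 r0.
rewrite (_ : _ + _ = P * D * (P * r - D)); last by rewrite /D; ring.
have D0 : 0 <= D by rewrite addr_ge0 ?sqr_ge0.
move=> h; case: (ltrP (P * r) D) => // lt_D; exfalso.
have Dp : 0 < D by rewrite (le_lt_trans _ lt_D) // mulr_ge0 // ltW.
by move: h; rewrite pmulr_rge0 ?mulr_gt0 // subr_ge0 leNgt lt_D.
Qed.

End DotProduct.

(** Williamson normal form of one mode, found by completing the square: [S] is lower triangular,
    with [s] chosen so that [s ^+ 2 * G 0 0] is the square root of the determinant. *)
Lemma scalar_congr2 (R : realType) (G : 'M[R]_2) :
  G 1 0 = G 0 1 -> 0 < G 0 0 -> 0 < \det G ->
  exists2 S : 'M[R]_2, \det S = 1 & S *m G *m S^T = (Num.sqrt (\det G))%:M.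
Proof.
move=> G10 p0 d0; set a := Num.sqrt (\det G).
have a0 : 0 < a by rewrite sqrtr_gt0.
have aa : a ^+ 2 = \det G by rewrite sqr_sqrtr // ltW.
set s := Num.sqrt (a / G 0 0).
have s0 : 0 < s by rewrite sqrtr_gt0 divr_gt0.
have sp : s ^+ 2 * G 0 0 = a.
  by rewrite sqr_sqrtr ?divfK ?lt0r_neq0 // ltW // divr_gt0.
pose S : 'M[R]_2 := \matrix_(i, j) if i == 0 then (if j == 0 then s else 0)
                       else (if j == 0 then - G 0 1 / (s * G 0 0) else s^-1).
have [pn sn] : G 0 0 != 0 /\ s != 0 by split; exact: lt0r_neq0.
exists S; first by rewrite det_mx22 !mxE /=; field; rewrite pn sn.
have aE : a = (G 0 0 * G 1 1 - G 0 1 * G 0 1) / (s ^+ 2 * G 0 0).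
  by move: aa; rewrite det_mx22 G10 => <-; rewrite sp expr2 mulfK // lt0r_neq0.
apply/matrixP; elim/ord2_ind; elim/ord2_ind; rewrite !mulmx2E !mxE /= ?G10.
- by rewrite -sp; ring.
- by field; rewrite pn sn.
- by field; rewrite pn sn.
- by rewrite [RHS]aE; field; rewrite pn sn.
Qed.

(** * Gram matrices of the row pairs belonging to one or two modes *)

Section TwoModes.
Variables (R : realType) (N : nat) (J : 'M[R]_N).
Hypothesis J_tr : J^T = - J.
Hypothesis J_sqr : J *m J = - 1%:M.
Implicit Types (x y : 'rV[R]_N) (A B : 'M[R]_(2, N)).

Lemma dotmxJJ x y : dotmx (x *m J) (y *m J) = dotmx x y.
Proof.
rewrite /dotmx trmx_mul J_tr mulNmx mulmxN mulmxA -(mulmxA x) J_sqr.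
by rewrite mulmxN mulNmx mulmx1 opprK.
Qed.

Lemma dotmxJr x y : dotmx x (y *m J) = - dotmx (x *m J) y.
Proof. by rewrite /dotmx trmx_mul J_tr mulNmx mulmxN mxE mulmxA. Qed.

Lemma dotmxJ x : dotmx (x *m J) x = 0.
Proof. by have := dotmxC (x *m J) x; rewrite dotmxJr; lra. Qed.

Lemma gram_det_ge1 A : A *m J *m A^T = sigma1 R ->
  0 < (A *m A^T) 0 0 /\ 1 <= \det (A *m A^T).
Proof.
move=> hA; have /= := congr1 (fun M : 'M[R]_2 => M 0 1) hA.
rewrite mulmx_trE sigma1E row_mul.
rewrite det_mx22 !mulmx_trE.
move: (row 0 A) (row 1 A) => a b ab.
have a0 : 0 < dotmx a a.
  rewrite lt_neqAle dotmx_ge0 andbT eq_sym dotmx_eq0.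
  by apply/eqP => z; move: ab; rewrite z mul0mx /dotmx mul0mx mxE; lra.
split=> //.
(* Since [a *m J] pairs to 1 with [b] and to 0 with [a], this squared norm equals [dotmx a a] times
   the Gram determinant minus 1. *)
have := dotmx_ge0 (dotmx a a *: b + (- dotmx a b) *: a + (- 1) *: (a *m J)).
rewrite !(dotmxDl, dotmxDr, dotmxZl, dotmxZr) !dotmxJJ.
rewrite (dotmxC b (_ *m _)) (dotmxC a (_ *m _)) (dotmxC b a) dotmxJ ab.
rewrite -[1 <= _]subr_ge0 -(pmulr_rge0 _ a0) => h.
by apply: le_trans h _; rewrite le_eqVlt; apply/orP; left; apply/eqP; ring.
Qed.

Lemma gram_normal_form A : A *m J *m A^T = sigma1 R ->
  exists2 S : 'M[R]_2, \det S = 1 &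
    (S *m A) *m (S *m A)^T = (Num.sqrt (\det (A *m A^T)))%:M.
Proof.
move=> /gram_det_ge1[p0 d1].
have G10 : (A *m A^T) 1 0 = (A *m A^T) 0 1 by rewrite !mulmx_trE dotmxC.
have [|S S1 SE] := scalar_congr2 G10 p0; first exact: lt_le_trans d1.
by exists S => //; rewrite trmx_mul mulmxA -(mulmxA S).
Qed.

Lemma cross_det_bound_normal A B (a b : R) :
  A *m J *m A^T = sigma1 R -> B *m J *m B^T = sigma1 R -> A *m J *m B^T = 0 ->
  A *m A^T = a%:M -> B *m B^T = b%:M -> 0 < a ->
  - \det (A *m B^T) <= (a + 1) * (b - 1).
Proof.
move=> hA hB hAB hAA hBB a0.
rewrite det_mx22 !mulmx_trE.
have {hA}/=  := congr1 (fun M : 'M[R]_2 => M 0 1) hA.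
have {hB}/= := congr1 (fun M : 'M[R]_2 => M 0 1) hB.
have /matrixP := hAB => {}hAB.
have := (hAB 0 0, hAB 0 1, hAB 1 0, hAB 1 1) => {hAB}.
have /matrixP := hAA => {}hAA.
have := (hAA 0 0, hAA 0 1, hAA 1 1) => {hAA}.
have /matrixP := hBB => {}hBB.
have := (hBB 0 0, hBB 0 1, hBB 1 1) => {hBB}.
rewrite !mulmx_trE !sigma1E !row_mul !mxE /=.
move: (row 0 A) (row 1 A) (row 0 B) (row 1 B) => a1 a2 b1 b2.
move=> [[b11 b12] b22] [[a11 a12] a22] [[[ab11 ab12] ab21] ab22] bJ aJ.
(* Cauchy-Schwarz for the complex vectors [a1 + i a2] and [b1 - i b2], with [- J]
   in the role of [i]. *)
pose p := a1 + a2 *m - J; pose q := b1 + b2 *m J; pose q' := b2 + b1 *m - J.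
have := @bessel2 _ _ p q q'.
have dN x y : dotmx (- x) y = - dotmx x y by rewrite -scaleN1r dotmxZl mulN1r.
have dNr x y : dotmx x (- y) = - dotmx x y by rewrite dotmxC dN dotmxC.
rewrite /p /q /q' !mulmxN !(dotmxDl, dotmxDr, dN, dNr, dotmxJJ) !dotmxJr.
have b2J : dotmx (b2 *m J) b1 = -1 by rewrite dotmxC dotmxJr bJ.
have a2J : dotmx (a2 *m J) a1 = -1 by rewrite dotmxC dotmxJr aJ.
rewrite !dotmxJ (dotmxC b2 b1) b2J a2J aJ bJ ab11 ab12 ab21 ab22 a11 a22 b11 b12 b22.
rewrite !mulr1n !mulr0n.
move: (dotmx a1 b1) (dotmx a2 b2) (dotmx a1 b2) (dotmx a2 b1) => c11 c22 c12 c21 H.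
(* The cross terms vanish by [A *m J *m B^T = 0], so [p] pairs with [q] and [q'] to [c11 - c22] and
   [c12 + c21]. The squared norms of [p] and [q] are [2 * (a + 1)] and [2 * (b - 1)]. *)
have {}H : (c11 - c22) ^+ 2 + (c12 + c21) ^+ 2 <= 4 * ((a + 1) * (b - 1)).
  have -> : 4 * ((a + 1) * (b - 1)) =
      (a - - 1 + (- - 1 - - a)) * (b - 1 + (- 1 + b)) by ring.
  apply: le_trans (H _ _ _); [|lra..].
  by rewrite le_eqVlt; apply/orP; left; apply/eqP; ring.
(* Polarization: four times the negated determinant is the left side of [H] minus these two
   squares. *)
have := sqr_ge0 (c11 + c22); have := sqr_ge0 (c12 - c21); move: H; nra.
Qed.

(** Determinant-one changes of basis in the two modes make both diagonal Gram blocks scalar; they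
    preserve the symplectic relations and the determinant of the cross block. *)
Lemma cross_det_bound A B :
  A *m J *m A^T = sigma1 R -> B *m J *m B^T = sigma1 R -> A *m J *m B^T = 0 ->
  - \det (A *m B^T) <=
  (Num.sqrt (\det (A *m A^T)) + 1) * (Num.sqrt (\det (B *m B^T)) - 1).
Proof.
move=> hA hB hAB.
have [S S1 SE] := gram_normal_form hA; have [T T1 TE] := gram_normal_form hB.
have congrJ (U : 'M[R]_2) C : \det U = 1 -> C *m J *m C^T = sigma1 R ->
    (U *m C) *m J *m (U *m C)^T = sigma1 R.
  move=> U1 hC; rewrite trmx_mul !mulmxA -(mulmxA U C) -(mulmxA U (C *m J)) hC.
  by rewrite sigma1_congr U1 mul1mx.
have -> : \det (A *m B^T) = \det ((S *m A) *m (T *m B)^T).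
  by rewrite trmx_mul mulmxA -(mulmxA S) !det_mulmx det_tr S1 T1 mul1r mulr1.
apply: cross_det_bound_normal => //; [exact: congrJ|exact: congrJ| |].
- by rewrite trmx_mul !mulmxA -(mulmxA S A) -(mulmxA S (A *m J)) hAB mulmx0 mul0mx.
- by have [_ d1] := gram_det_ge1 hA; rewrite sqrtr_gt0 (lt_le_trans _ d1).
Qed.
End TwoModes.

(** * The inequality for the one-mode marginals of a pure state *)

Section PureMarginals.
Variables (R : realType) (n : nat).

Lemma pure_factor (rho : gaussian_state R n) : pure rho ->
  exists2 T, symplectic T & cov rho = T *m T^T.
Proof.
case=> S; rewrite /symplectic; set s := sigma R n => hS hSg.
have ss : s *m s = - 1%:M := sigma_sqr R n.
(* The inverse of a symplectic matrix, by [S *m s *m S^T = s] and [s *m s = - 1%:M]. *)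
pose T := - (s *m S^T *m s).
have ST : S *m T = 1%:M.
  by rewrite /T mulmxN !mulmxA hS ss opprK.
have TS : T *m S = 1%:M := mulmx1C ST.
have STt : S^T *m T^T = 1%:M by rewrite -trmx_mul TS trmx1.
exists T; last first.
  rewrite -[LHS]mul1mx -[LHS]mulmx1 -{1}TS -STt -!mulmxA (mulmxA S).
  by rewrite (mulmxA _ S^T) hSg mul1mx.
rewrite -{1}hS.
by rewrite !mulmxA TS mul1mx -mulmxA STt mulmx1.
Qed.

Lemma symplectic_tr (T : 'M[R]_(phase_dim n)) : symplectic T -> symplectic T^T.
Proof.
rewrite /symplectic trmxK => hT; set s := sigma R n in hT *.
have ss : s *m s = - 1%:M := sigma_sqr R n.
have /mulmx1C h : T *m - (s *m T^T *m s) = 1%:M.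
  by rewrite mulmxN !mulmxA hT ss opprK.
have := congr1 (mulmx s) h.
by rewrite mulmx1 mulNmx mulmxN !mulmxA ss !mulNmx mul1mx opprK.
Qed.

Lemma symplectic_submxcol (T : 'M[R]_(phase_dim n)) j k : symplectic T ->
  submxcol T j *m sigma R n *m (submxcol T k)^T = if j == k then sigma1 R else 0.
Proof.
move=> hT.
have := congr1 (fun M : 'M[R]_(phase_dim n) => submxblock M j k) hT.
rewrite [in X in _ = X]sigma_block mxblockK => <-.
by rewrite submxblockEh -mul_submxrow !submxcol_mul tr_submxcol.
Qed.

Lemma pure_marginals (rho : gaussian_state R n) (j : 'I_n) : pure rho ->
  let c k := Num.sqrt (\det (submxblock (cov rho) k k)) in
  1 <= c j /\ c j - 1 <= \sum_(k < n | k != j) (c k - 1).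
Proof.
move=> /pure_factor[T hT covE] c.
(* The two rows of [T] that belong to mode [k]; the blocks of the covariance matrix are their mutual
   Gram matrices. *)
pose A k := submxcol T k.
have covA i k : submxblock (cov rho) i k = A i *m (A k)^T.
  by rewrite covE submxblockEh -mul_submxrow submxcol_mul tr_submxcol.
have hA i : A i *m sigma R n *m (A i)^T = sigma1 R.
  by rewrite symplectic_submxcol ?eqxx.
have c1 i : 1 <= c i.
  have [_ d1] := gram_det_ge1 (sigma_tr R n) (sigma_sqr R n) (hA i).
  by rewrite -sqrtr1 /c ler_wsqrtr // covA.
have cc i : c i ^+ 2 = \det (submxblock (cov rho) i i).
  rewrite sqr_sqrtr // ltW //.
  have [_ d1] := gram_det_ge1 (sigma_tr R n) (sigma_sqr R n) (hA i).
  by rewrite covA (lt_le_trans _ d1).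
split=> //.
(* Both [T] and its transpose are symplectic, so the covariance matrix preserves [sigma] too. In its
   diagonal block [j], each summand is [sigma1] times the determinant of a block. *)
have sum_det : \sum_k \det (submxblock (cov rho) j k) = 1.
  have hTt : T^T *m sigma R n *m T = sigma R n.
    by have := symplectic_tr hT; rewrite /symplectic trmxK.
  have : submxblock (cov rho *m sigma R n *m cov rho) j j = sigma1 R.
    rewrite covE !mulmxA -(mulmxA T) -(mulmxA T) hTt hT.
    by rewrite submxblock_diag.
  rewrite -[in cov rho *m _](submxblockK (cov rho)) -{2}(submxblockK (cov rho)).
  rewrite mul_mxblock_mxdiag mul_mxblock mxblockK.
  move/(congr1 (fun M : 'M[R]_2 => M 0 1)); rewrite sigma1E summxE => <-.
  apply: eq_bigr => k _.
  have -> : submxblock (cov rho) k j = (submxblock (cov rho) j k)^T.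
    by rewrite !covA trmx_mul trmxK.
  by rewrite sigma1_congr mul_scalar_mx mxE sigma1E mulr1.
have bound k : k != j -> - \det (submxblock (cov rho) j k) <= (c j + 1) * (c k - 1).
  move=> kj; rewrite /c !covA.
  apply: (cross_det_bound (sigma_tr R n) (sigma_sqr R n)) => //.
  by rewrite symplectic_submxcol // eq_sym (negPf kj).
move: sum_det; rewrite (bigD1 j) //= -cc => sum_det.
have : \sum_(k < n | k != j) - \det (submxblock (cov rho) j k) <=
    \sum_(k < n | k != j) (c j + 1) * (c k - 1) by exact: ler_sum.
rewrite sumrN -mulr_sumr => le_sum.
have cp : 0 < c j + 1 by have := c1 j; lra.
rewrite -(ler_pM2l cp) (le_trans _ le_sum) //.
rewrite -[X in _ <= - X](addKr (c j ^+ 2)) sum_det le_eqVlt; apply/orP; left.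
by apply/eqP; ring.
Qed.

End PureMarginals.

(** * States without position-momentum correlations *)

Section PureFromSymplectic.
Variables (R : realType) (n : nat).

Lemma toC_adj m p (A : 'M[R]_(m, p)) : (toC A) ^t* = toC A^T.
Proof. by apply/matrixP => a b; rewrite !mxE; exact: conjc_real. Qed.

Lemma toCM m p q (A : 'M[R]_(m, p)) (B : 'M[R]_(p, q)) :
  toC (A *m B) = toC A *m toC B.
Proof. exact: map_mxM. Qed.

Lemma adjmx_mul m p q (A : 'M[R[i]]_(m, p)) (B : 'M[R[i]]_(p, q)) :
  (A *m B) ^t* = B ^t* *m A ^t*.
Proof. by rewrite trmx_mul map_mxM. Qed.

Lemma adjmxK m p (A : 'M[R[i]]_(m, p)) : (A ^t*) ^t* = A.
Proof. by apply/matrixP => a b; rewrite !mxE conjCK. Qed.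

Lemma psdmx_gram m p (A : 'M[R[i]]_(m, p)) (c : R[i]) : 0 <= c ->
  psdmx (c *: (A *m A ^t*)).
Proof.
move=> c0; split.
  apply/is_hermitianmxP; rewrite expr0 scale1r linearZ /= map_mxZ.
  by rewrite adjmx_mul adjmxK; congr (_ *: _); exact/esym/geC0_conj.
move=> v; rewrite -scalemxAr -scalemxAl mxE mulr_ge0 //.
rewrite mulmxA -(mulmxA (v *m A)) -adjmx_mul mxE sumr_ge0 // => k _.
by rewrite !mxE mul_conjC_ge0.
Qed.

(** For the vacuum, [G = 1 + i sigma] is hermitian with [G^2 = 2 G]. Since [T] fixes [sigma], the
    matrix in question is [T G T^T], half of the Gram matrix of [T G]. *)
Lemma symplectic_uncertainty (T : 'M[R]_(phase_dim n)) : symplectic T ->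
  psdmx (toC (T *m T^T) + 'i%C *: toC (sigma R n)).
Proof.
move=> hT; set s := sigma R n.
pose G : 'M[R[i]]_(phase_dim n) := 1%:M + 'i%C *: toC s.
have Gadj : G ^t* = G.
  rewrite /G linearD /= map_mxD linearZ /= map_mxZ toC_adj sigma_tr.
  rewrite trmx1 map_mx1; congr (_ + _).
  rewrite /toC map_mxN scalerN -scaleNr; congr (_ *: _).
  by rewrite complexiE; apply: (canLR opprK); rewrite -conjCi.
have GG : G *m G = 2%:R *: G.
  have ii : 'i%C * 'i%C = -1 :> R[i] by rewrite -expr2 sqr_i.
  rewrite {1}/G mulmxDl mul1mx -scalemxAl {2}/G mulmxDr mulmx1 -scalemxAr -toCM.
  rewrite sigma_sqr /toC map_mxN map_mx1 scalerDr scalerA ii scaleNr scale1r.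
  by rewrite opprK [X in _ + X]addrC scaler_nat mulr2n.
have -> : toC (T *m T^T) + 'i%C *: toC s =
    2%:R^-1 *: ((toC T *m G) *m (toC T *m G) ^t*).
  rewrite adjmx_mul Gadj toC_adj mulmxA -(mulmxA (toC T)) GG.
  rewrite -scalemxAr -scalemxAl scalerA mulVf ?pnatr_eq0 // scale1r.
  rewrite /G mulmxDr mulmx1 mulmxDl -toCM; congr (_ + _).
  by rewrite -scalemxAr -scalemxAl -!toCM hT.
by apply: psdmx_gram; rewrite invr_ge0 ler0n.
Qed.

Lemma pure_of_symplectic (T : 'M[R]_(phase_dim n)) : symplectic T ->
  exists2 rho : gaussian_state R n, pure rho & cov rho = T *m T^T.
Proof.
move=> hT.
have sym : (T *m T^T)^T = T *m T^T by rewrite trmx_mul trmxK.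
exists (GaussianState 0 sym (symplectic_uncertainty hT)) => //=.
move: hT; rewrite /symplectic => hT.
have ss := sigma_sqr R n; move: hT ss (sigma_tr R n).
rewrite /pure /symplectic /=; set s := sigma R n => hT ss st.
have TS : T *m - (s *m T^T *m s) = 1%:M by rewrite mulmxN !mulmxA hT ss opprK.
have ST := mulmx1C TS.
move: (- _) TS ST => S TS ST; exists S.
  rewrite -{1}hT !mulmxA ST mul1mx -mulmxA.
  by rewrite -trmx_mul ST trmx1 mulmx1.
by rewrite mulmxA ST mul1mx -trmx_mul ST trmx1.
Qed.

Definition diag2 (x p : R) : 'M[R]_2 :=
  \matrix_(i, j) if i == j then if i == 0 then x else p else 0.

(** The direct sum of [X] on positions and [P] on momenta, written in the interleaved order of
    coordinates. *)
Definition pos_mom (X P : 'M[R]_n) : 'M[R]_(phase_dim n) :=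
  \mxblock_(j < n, k < n) diag2 (X j k) (P j k).

Lemma pos_mom_tr (X P : 'M[R]_n) : (pos_mom X P)^T = pos_mom X^T P^T.
Proof.
rewrite tr_mxblock; apply/eq_mxblock => j k; apply/matrixP => a b.
by rewrite !mxE eq_sym; case: eqP => // ->.
Qed.

Lemma pos_mom_mul (X P Y Q : 'M[R]_n) :
  pos_mom X P *m pos_mom Y Q = pos_mom (X *m Y) (P *m Q).
Proof.
rewrite mul_mxblock; apply/eq_mxblock => j k; apply/matrixP.
by elim/ord2_ind; elim/ord2_ind; rewrite summxE !mxE /=;
  first [apply: eq_bigr | apply: big1] => i _; rewrite mulmx2E !mxE /=; ring.
Qed.

Lemma pos_mom_sigma (X P : 'M[R]_n) :
  pos_mom X P *m sigma R n = sigma R n *m pos_mom P X.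
Proof.
rewrite mul_mxblock_mxdiag mul_mxdiag_mxblock; apply/eq_mxblock => j k.
by apply/matrixP; elim/ord2_ind; elim/ord2_ind;
  rewrite !mulmx2E !sigma1E !mxE /=; ring.
Qed.

Lemma pos_mom1 : pos_mom 1%:M 1%:M = 1%:M.
Proof.
rewrite -(mxdiagZ (p_ := fun=> 2%N)); apply/eq_mxblock => j k.
rewrite conform_mx_id; apply/matrixP => a b; rewrite !mxE.
by case: (j == k); rewrite !mxE; case: (a == b); case: (a == 0).
Qed.

(** Moving [sigma] across exchanges the position and momentum parts, so the symplectic condition
    becomes [K *m L^T = 1] together with its transpose. *)
Lemma pos_mom_symplectic (L K : 'M[R]_n) : L *m K^T = 1%:M ->
  symplectic (pos_mom L K).
Proof.
move=> LK; rewrite /symplectic pos_mom_sigma -mulmxA pos_mom_tr pos_mom_mul LK.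
by rewrite -[K *m _]trmxK trmx_mul trmxK LK trmx1 pos_mom1 mulmx1.
Qed.

Lemma pure_of_pos_mom (L K : 'M[R]_n) (c : 'I_n -> R) : L *m K^T = 1%:M ->
  (forall j, 0 <= c j) ->
  (forall j, (L *m L^T) j j = c j) -> (forall j, (K *m K^T) j j = c j) ->
  exists2 rho : gaussian_state R n, pure rho &
    forall j, Num.sqrt (\det (submxblock (cov rho) j j)) = c j.
Proof.
move=> /pos_mom_symplectic/pure_of_symplectic[rho prho covE] c0 hL hK.
exists rho => // j; rewrite covE pos_mom_tr pos_mom_mul mxblockK det_mx22 !mxE /=.
move: (hL j) (hK j); rewrite !mxE => -> ->.
by rewrite mulr0 subr0 -expr2 sqrtr_sqr ger0_norm.
Qed.

End PureFromSymplectic.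

(** * Realizing all admissible spectra *)

Section FewModes.
Variable R : realType.

(** Both diagonals are required to equal [c], so every one-mode block is the scalar matrix [c j].
    This local normal form is what survives mixing with vacuum modes. *)
Definition realizable n (c : 'I_n -> R) := exists L K : 'M[R]_n,
  [/\ L *m K^T = 1%:M, forall j, (L *m L^T) j j = c j &
      forall j, (K *m K^T) j j = c j].

(** Only the product of the two variances is invariant under squeezing a single mode. Scaling
    position [j] by [d 0 j] and momentum [j] by its inverse makes both variances equal to [c j]. *)
Lemma realizable_rescale n (c : 'I_n -> R) (L K : 'M[R]_n) :
  L *m K^T = 1%:M -> (forall j, 0 < c j) ->
  (forall j, (L *m L^T) j j * (K *m K^T) j j = c j ^+ 2) -> realizable c.
Proof.
move=> LK c0 LLKK.
have L0 j : 0 < (L *m L^T) j j.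
  rewrite lt_neqAle mulmx_trE dotmx_ge0 andbT eq_sym; apply/eqP => z.
  have := LLKK j; rewrite mulmx_trE z mul0r => /esym/eqP.
  by rewrite sqrf_eq0 gt_eqF.
have [d d0 dd] : exists2 d : 'rV[R]_n, forall j, d 0 j != 0 &
    forall j, d 0 j ^+ 2 = c j / (L *m L^T) j j.
  exists (\row_j Num.sqrt (c j / (L *m L^T) j j)) => j; rewrite mxE.
    by rewrite gt_eqF // sqrtr_gt0 divr_gt0.
  by rewrite sqr_sqrtr // ltW // divr_gt0.
have diagE (e : 'rV[R]_n) (X : 'M[R]_n) j :
    (diag_mx e *m X *m (diag_mx e *m X)^T) j j = e 0 j ^+ 2 * (X *m X^T) j j.
  rewrite trmx_mul tr_diag_mx mulmxA -(mulmxA (diag_mx e)).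
  rewrite mul_mx_diag mul_diag_mx !mxE.
  ring.
exists (diag_mx d *m L), (diag_mx (map_mx GRing.inv d) *m K); split=> [|j|j].
- rewrite trmx_mul tr_diag_mx mulmxA -(mulmxA (diag_mx d)) LK mulmx1.
  apply/matrixP => i j; rewrite mul_diag_mx !mxE.
  by case: eqP => [->|_]; rewrite ?mulr0 // !mulr1n mulfV.
- by rewrite diagE dd divfK // gt_eqF.
- rewrite diagE mxE exprVn dd invf_div mulrAC.
  by rewrite LLKK expr2 mulfK // gt_eqF.
Qed.

(** [W] embeds [p] modes isometrically into [n], and [F] extends a matrix by the identity, that is
    by vacuum, on the orthogonal complement of the range. [F] is multiplicative because
    [W^T *m W = 1]. A row of [W] has its only possibly nonzero entry at [g j], so a diagonal entry
    of [F X] sees a single diagonal entry of [X]. *)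
Lemma realizable_isometry p n (W : 'M[R]_(n, p)) (g : 'I_n -> 'I_p)
    (c : 'I_n -> R) (b : 'I_p -> R) : W^T *m W = 1%:M ->
  (forall j h, h != g j -> W j h = 0) ->
  (forall j, c j - 1 = W j (g j) ^+ 2 * (b (g j) - 1)) ->
  realizable b -> realizable c.
Proof.
move=> WW Wg cE [L [K [LK LL KK]]].
pose F (X : 'M[R]_p) : 'M[R]_n := 1%:M + W *m (X - 1%:M) *m W^T.
have FM X Y : F X *m F Y = F (X *m Y).
  rewrite /F mulmxDl mul1mx mulmxDr mulmx1 -addrA; congr (_ + _).
  rewrite !mulmxA -(mulmxA _ W^T W) WW mulmx1 -!mulmxDl; congr (_ *m _).
  rewrite -(mulmxA W) -!mulmxDr; congr (_ *m _).
  rewrite mulmxBl mul1mx mulmxBr mulmx1; move: (X *m Y) => Z.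
  by apply/matrixP => i j; rewrite !mxE; ring.
have FT X : (F X)^T = F X^T.
  by rewrite /F linearD /= trmx1 !trmx_mul trmxK linearB /= trmx1 mulmxA.
have F1 : F 1%:M = 1%:M by rewrite /F subrr mulmx0 mul0mx addr0.
have FE X j : (F X) j j = 1 + W j (g j) ^+ 2 * (X (g j) (g j) - 1).
  rewrite mxE [1%:M _ _]mxE eqxx; congr (_ + _).
  rewrite mxE (bigD1 (g j)) //= big1 ?addr0 => [|h hg]; last first.
    by rewrite [W^T _ _]mxE Wg // mulr0.
  rewrite [W^T _ _]mxE mxE (bigD1 (g j)) //= big1 ?addr0 => [|h hg]; last first.
    by rewrite Wg // mul0r.
  by rewrite !mxE eqxx mulr1n; ring.
exists (F L), (F K); split=> [|j|j]; rewrite FT FM ?LK ?F1 // FE ?LL ?KK -cE; ring.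
Qed.

(** Mode [h] is spread over its fibre under [g] with amplitudes the square roots of the relative
    weights. The section [r] makes every fibre nonempty, so that each column of [W] can have norm
    one. *)
Lemma realizable_merge p n (g : 'I_n -> 'I_p) (r : 'I_p -> 'I_n)
    (c : 'I_n -> R) : cancel r g -> (forall j, 1 <= c j) ->
  realizable (fun h => 1 + \sum_(j | g j == h) (c j - 1)) -> realizable c.
Proof.
move=> rK c1; set M := fun h => \sum_(j | g j == h) (c j - 1).
have m0 j : 0 <= c j - 1 by rewrite subr_ge0.
have M0 h : 0 <= M h by exact: sumr_ge0.
(* A class of weight 0 still needs a unit column for W to be an isometry. *)
pose w j := if M (g j) == 0 then (j == r (g j))%:R
            else Num.sqrt ((c j - 1) / M (g j)).
pose W : 'M[R]_(n, p) := \matrix_(j, h) if h == g j then w j else 0.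
apply: (@realizable_isometry _ _ W g) => [|j h /negPf hg|j].
- apply/matrixP => h h'; rewrite !mxE.
  have [<-|hh'] := eqVneq h h'; last first.
    rewrite big1 // => j _; rewrite !mxE.
    case: eqP => [hg|]; rewrite ?mul0r //.
    by rewrite -hg eq_sym (negPf hh') mulr0.
  transitivity (\sum_(j | g j == h) w j ^+ 2).
    rewrite [RHS]big_mkcond; apply: eq_bigr => j _; rewrite !mxE eq_sym.
    by case: eqP; rewrite ?mulr0 ?expr2.
  rewrite /w; have [Mh|Mh] := eqVneq (M h) 0.
    rewrite (bigD1 (r h)) /= ?rK ?eqxx // Mh eqxx expr1n big1 ?addr0 //.
    by move=> j /andP[/eqP-> /negPf ->]; rewrite Mh eqxx expr0n.
  rewrite -[RHS](mulfV Mh) mulr_suml; apply: eq_bigr => j /eqP->.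
  by rewrite (negPf Mh) sqr_sqrtr // divr_ge0.
- by rewrite mxE hg.
- rewrite mxE eqxx addrAC subrr add0r -/(M _) /w.
  case: eqP => [Mg|/eqP Mg].
    have := M0 (g j); rewrite Mg mulr0 => _.
    move/eqP: Mg; rewrite psumr_eq0 // => /allP/(_ j).
    by rewrite mem_index_enum eqxx => /(_ isT)/eqP.
  by rewrite sqr_sqrtr ?divfK // divr_ge0.
Qed.

(* Up to positive factors, [x ^+ 2 - 1] and [x ^+ 2 * (1 - y ^+ 2)] are Heron's
   16 area^2 for the triangles with sides [b, e, a + 1] and [b, e, a - 1]. *)
Lemma squeezing_parameters (a b e : R) : 1 <= a -> 1 <= b -> 1 <= e ->
  a - 1 <= (b - 1) + (e - 1) -> b - 1 <= (a - 1) + (e - 1) ->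
  e - 1 <= (a - 1) + (b - 1) ->
  exists x y : R, [/\ 1 <= x, -1 <= y <= 1,
    4 * b ^+ 2 = 4 * a * x ^+ 2 + (a - 1) ^+ 2 * (1 + x ^+ 2 * y ^+ 2)
                 + 2 * (a ^+ 2 - 1) * (x * y) &
    4 * e ^+ 2 = 4 * a * x ^+ 2 + (a - 1) ^+ 2 * (1 + x ^+ 2 * y ^+ 2)
                 - 2 * (a ^+ 2 - 1) * (x * y)].
Proof.
move=> a1 b1 e1 ha hb he.
(* Subtracting the two required equations forces [x * y = w], and adding them forces [x ^+ 2 = X].
   If [a = 1], then [b = e] and the division by zero yields [w = 0], which is still a solution. *)
set w := (b ^+ 2 - e ^+ 2) / (a ^+ 2 - 1).
have wE : (a ^+ 2 - 1) * w = b ^+ 2 - e ^+ 2.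
  have [a_1|a_1] := eqVneq a 1; last by rewrite mulrC divfK //; nra.
  by rewrite a_1 expr1n subrr mul0r (_ : b = e) ?subrr //; lra.
set X := (2 * (b ^+ 2 + e ^+ 2) - (a - 1) ^+ 2 * (1 + w ^+ 2)) / (4 * a).
have a0 : a != 0 by rewrite gt_eqF //; lra.
have XE : 4 * a * X = 2 * (b ^+ 2 + e ^+ 2) - (a - 1) ^+ 2 * (1 + w ^+ 2).
  by rewrite mulrC divfK // mulf_neq0 // pnatr_eq0.
have X1 : 1 <= X.
  have : 0 <= (4 * a * X - 4 * a) * (a + 1) ^+ 2.
    rewrite XE (_ : _ * _ = 2 * (b ^+ 2 + e ^+ 2) * (a + 1) ^+ 2 - (a + 1) ^+ 4
        - ((a ^+ 2 - 1) * w) ^+ 2); last by ring.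
    rewrite wE (_ : _ - _ = (b + e + (a + 1)) * (b + e - (a + 1)) *
      ((a + 1 + b - e) * (a + 1 - b + e))); last by ring.
    by rewrite !mulr_ge0 //; lra.
  rewrite pmulr_lge0; last by apply: exprn_gt0; lra.
  nra.
(* This is the bound on [y], since [y] will be [w / x]. *)
have wX : w ^+ 2 <= X.
  have [a_1|a_1] := eqVneq a 1.
    by rewrite /w a_1 expr1n subrr invr0 mulr0 expr0n /=; lra.
  have : 0 <= (4 * a * X - 4 * a * w ^+ 2) * (a - 1) ^+ 2.
    rewrite XE (_ : _ * _ = 2 * (b ^+ 2 + e ^+ 2) * (a - 1) ^+ 2 - (a - 1) ^+ 4
        - ((a ^+ 2 - 1) * w) ^+ 2); last by ring.
    rewrite wE (_ : _ - _ = (b + e + (a - 1)) * (b + e - (a - 1)) *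
      ((a - 1 + b - e) * (a - 1 - b + e))); last by ring.
    by rewrite !mulr_ge0 //; lra.
  rewrite pmulr_lge0; last by rewrite exprn_gt0 // subr_gt0 lt_neqAle eq_sym a_1.
  nra.
set x := Num.sqrt X; have xx : x ^+ 2 = X by rewrite sqr_sqrtr //; lra.
have x1 : 1 <= x by rewrite -sqrtr1 ler_wsqrtr.
have xw : x * (w / x) = w by rewrite mulrC divfK // gt_eqF //; lra.
exists x, (w / x); split=> //.
- have : (w / x) ^+ 2 <= 1.
    by rewrite exprMn exprVn xx ler_pdivrMr ?mul1r //; lra.
  by move: (w / x) => y yy; apply/andP; split; nra.
- by rewrite -exprMn xw xx -(mulrA 2) wE; lra.
- by rewrite -exprMn xw xx -(mulrA 2) wE; lra.
Qed.

Lemma realizable1 (c : 'I_1 -> R) : c ord0 = 1 -> realizable c.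
Proof.
move=> c1; exists 1%:M, 1%:M; rewrite trmx1 mulmx1.
by split=> // j; rewrite ord1 c1 mxE.
Qed.

(** Two-mode squeezed vacuum: [h] and [l] are the hyperbolic cosine and sine of the squeezing, and
    negating [l] inverts the matrix. *)
Lemma realizable2 (c : 'I_2 -> R) : 1 <= c 0 -> c 0 = c 1 -> realizable c.
Proof.
move=> c1 c01.
pose h := Num.sqrt ((c 0 + 1) / 2); pose l := Num.sqrt ((c 0 - 1) / 2).
have hh : h ^+ 2 = (c 0 + 1) / 2 by rewrite sqr_sqrtr //; lra.
have ll : l ^+ 2 = (c 0 - 1) / 2 by rewrite sqr_sqrtr //; lra.
pose L t : 'M[R]_2 := \matrix_(i, j) if i == j then h else t.
exists (L l), (L (- l)); split; [apply/matrixP; elim/ord2_ind|..];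
  elim/ord2_ind; rewrite mulmx2E !mxE /=; rewrite -?c01; nra.
Qed.

Lemma ord3_ind (P : 'I_3 -> Prop) : P (@Ordinal 3 0 isT) ->
  P (@Ordinal 3 1 isT) -> P (@Ordinal 3 2 isT) -> forall j, P j.
Proof.
move=> P0 P1 P2 [[|[|[|j]]] hj] //;
  [move: P0|move: P1|move: P2]; by congr P; apply/val_inj.
Qed.

Lemma sum_ord3 (F : 'I_3 -> R) : \sum_j F j =
  F (@Ordinal 3 0 isT) + F (@Ordinal 3 1 isT) + F (@Ordinal 3 2 isT).
Proof.
rewrite !big_ord_recl big_ord0 addr0 addrA.
by congr (F _ + F _ + F _); apply/val_inj.
Qed.

(* In position space: modes 0 and 1 are two-mode squeezed with parameters
   [h, l], then modes 1 and 2 are mixed by a beam splitter [al, be] and two-mode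
   squeezed with parameters [p, q]. The momentum matrix has [l, q] negated. *)
Definition three_mode_mx (h l al be p q : R) : 'M[R]_3 := \matrix_(i, j)
  nth 0 (nth [::] [:: [:: h; l; 0];
    [:: (p * al - q * be) * l; (p * al - q * be) * h; p * be + q * al];
    [:: (q * al - p * be) * l; (q * al - p * be) * h; q * be + p * al]] i) j.

Lemma realizable3 (c : 'I_3 -> R) : (forall j, 1 <= c j) ->
  (forall j, 2 * (c j - 1) <= \sum_k (c k - 1)) -> realizable c.
Proof.
move=> c1 c_le.
set a := c (@Ordinal 3 0 isT); set b := c (@Ordinal 3 1 isT).
set e := c (@Ordinal 3 2 isT).
have [||||||x [y [x1 /andP[y0 y1] bE eE]]] := @squeezing_parameters a b e;
  try exact: c1.
- by have := c_le (@Ordinal 3 0 isT); rewrite sum_ord3 -/a -/b -/e; lra.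
- by have := c_le (@Ordinal 3 1 isT); rewrite sum_ord3 -/a -/b -/e; lra.
- by have := c_le (@Ordinal 3 2 isT); rewrite sum_ord3 -/a -/b -/e; lra.
have a1 : 1 <= a by exact: c1.
(* Half-angle formulas: [a] and [x] are hyperbolic cosines of doubled squeezing parameters, and [y]
   is the cosine of twice the beam splitter angle. *)
pose hf (t : R) := Num.sqrt (t / 2).
have hfE t : 0 <= t -> hf t ^+ 2 = t / 2 by move=> t0; rewrite sqr_sqrtr //; lra.
have : hf (a + 1) ^+ 2 = (a + 1) / 2 by apply: hfE; lra.
have : hf (a - 1) ^+ 2 = (a - 1) / 2 by apply: hfE; lra.
have : hf (1 + y) ^+ 2 = (1 + y) / 2 by apply: hfE; lra.
have : hf (1 - y) ^+ 2 = (1 - y) / 2 by apply: hfE; lra.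
have : hf (x + 1) ^+ 2 = (x + 1) / 2 by apply: hfE; lra.
have : hf (x - 1) ^+ 2 = (x - 1) / 2 by apply: hfE; lra.
move: (hf (a + 1)) (hf (a - 1)) (hf (1 + y)) (hf (1 - y)) (hf (x + 1)) (hf (x - 1)).
move=> h l al be p q qq pp bb aa ll hh.
pose V s := three_mode_mx h (s * l) al be p (s * q).
have hl : h ^+ 2 - l ^+ 2 = 1 by rewrite hh ll; field.
have hl' : h ^+ 2 + l ^+ 2 = a by rewrite hh ll; field.
have pa : p ^+ 2 * al ^+ 2 + q ^+ 2 * be ^+ 2 = (x + y) / 2.
  by rewrite pp qq aa bb; field.
have pb : p ^+ 2 * be ^+ 2 + q ^+ 2 * al ^+ 2 = (x - y) / 2.
  by rewrite pp qq aa bb; field.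
set m := p * q * al * be.
have mm : m ^+ 2 = (x ^+ 2 - 1) * (1 - y ^+ 2) / 16.
  by rewrite /m !exprMn pp qq aa bb; field.
apply: (@realizable_rescale _ _ (V 1) (V (- 1))).
- apply/matrixP; elim/ord3_ind; elim/ord3_ind;
    rewrite mxE sum_ord3 !mxE /= ?mulr1n ?mulr0n.
  + by transitivity (h ^+ 2 - l ^+ 2); first by ring.
  + by ring.
  + by ring.
  + by ring.
  + transitivity ((p ^+ 2 * al ^+ 2 - q ^+ 2 * be ^+ 2) * (h ^+ 2 - l ^+ 2)
      + (p ^+ 2 * be ^+ 2 - q ^+ 2 * al ^+ 2)); first by ring.
    by rewrite hl pp qq aa bb; field.
  + transitivity ((h ^+ 2 - l ^+ 2 - 1) * - ((p * al - q * be) * (q * al + p * be)));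
      first by ring.
    by rewrite hl subrr mul0r.
  + by ring.
  + transitivity ((h ^+ 2 - l ^+ 2 - 1) * ((p * al + q * be) * (q * al - p * be)));
      first by ring.
    by rewrite hl subrr mul0r.
  + transitivity ((p ^+ 2 * be ^+ 2 - q ^+ 2 * al ^+ 2) * (h ^+ 2 - l ^+ 2)
      + (p ^+ 2 * al ^+ 2 - q ^+ 2 * be ^+ 2)); first by ring.
    by rewrite hl pp qq aa bb; field.
- by move=> j; have := c1 j; lra.
- elim/ord3_ind; rewrite !mulmx_trE !dotmx_sum !sum_ord3 !mxE /= -/a -/b -/e.
  + by transitivity ((h ^+ 2 + l ^+ 2) * (h ^+ 2 + l ^+ 2));
      [ring | rewrite hl' expr2].
  (* The term [2 * m * (a - 1)] enters the position and momentum variances with opposite signs, so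
     their product is a difference of squares. *)
  + transitivity ((a * ((x + y) / 2 - 2 * m) + ((x - y) / 2 + 2 * m))
      * (a * ((x + y) / 2 + 2 * m) + ((x - y) / 2 - 2 * m))).
      by rewrite -hl' -pa -pb /m; ring.
    transitivity ((a * (x + y) / 2 + (x - y) / 2) ^+ 2 - 4 * m ^+ 2 * (a - 1) ^+ 2).
      by field.
    by rewrite mm; apply: (@mulfI _ 4); rewrite ?pnatr_eq0 // bE; field.
  + transitivity ((a * ((x - y) / 2 - 2 * m) + ((x + y) / 2 + 2 * m))
      * (a * ((x - y) / 2 + 2 * m) + ((x + y) / 2 - 2 * m))).
      by rewrite -hl' -pa -pb /m; ring.
    transitivity ((a * (x - y) / 2 + (x + y) / 2) ^+ 2 - 4 * m ^+ 2 * (a - 1) ^+ 2).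
      by field.
    by rewrite mm; apply: (@mulfI _ 4); rewrite ?pnatr_eq0 // eE; field.
Qed.
End FewModes.

(** * Reduction of many modes to three *)

Section ManyModes.

Variable R : realType.

(** The absolute value is the difference between the sums over the two parts. Together with
    [a <= \sum_(z in U) f z], its bound gives the triangle inequalities for [a] and these two
    sums. *)
Lemma balanced_split (T : finType) (U : {set T}) (f : T -> R) (a : R) :
  (1 < #|U|)%N -> {in U, forall z, f z <= a} -> a <= \sum_(z in U) f z ->
  exists A : {set T}, [/\ A \subset U, A != finset.set0, U :\: A != finset.set0 &
    `|\sum_(z in U) f z - 2 * \sum_(z in A) f z| <= a].
Proof.
move=> U1 fa; set S := \sum_(z in U) f z => aS.
have [z0 z0U] : exists z, z \in U by apply/card_gt0P/ltnW.
have sumD1 (B : {set T}) z : z \in B ->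
    \sum_(i in B) f i = f z + \sum_(i in B :\ z) f i.
  by move=> zB; rewrite (big_setD1 z).
pose good (B : {set T}) :=
  [&& B \subset U, B != finset.set0 & S - 2 * \sum_(z in B) f z <= a].
have good0 : good (U :\ z0).
  have cU : (0 < #|U :\ z0|)%N by move: U1; rewrite (cardsD1 z0 U) z0U.
  rewrite /good subsetDl -card_gt0 cU /=.
  have Sz0 : S = _ := sumD1 _ _ z0U; have fz0 : f z0 <= a by exact: fa.
  by lra.
(* Removing one element from a smallest good set shifts the difference by at
   most [2 * a]. *)
case: (arg_minnP (fun B : {set T} => #|B|) good0) => A /and3P[AU A0 SA] Amin.
have /set0Pn[z zA] := A0; have zU := fintype.subsetP AU z zA.
exists A; split=> //.
  rewrite finset.setD_eq0; apply/negP => UA; have := Amin _ good0.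
  have -> : A = U by apply/eqP; rewrite finset.eqEsubset AU.
  by rewrite (cardsD1 z0 U) z0U ltnn.
rewrite ler_norml SA andbT; have := sumD1 _ _ zA.
(* If [A] is a singleton, the lower bound comes from [a <= S]; otherwise it comes from [A :\ z] not
   being good. *)
have [->|B0] := eqVneq (A :\ z) finset.set0.
  by rewrite big_set0; have := fa _ zU; lra.
have : ~~ good (A :\ z).
  by apply/negP => /Amin; rewrite (cardsD1 z A) zA ltnn.
rewrite /good B0 (fintype.subset_trans (subsetDl _ _) AU) /= -ltNge.
by have := fa _ zU; lra.
Qed.

(** One and two modes are treated directly: there the modes other than a largest one cannot be split
    into two nonempty parts. *)
Lemma polygon_realizable n (c : 'I_n.+1 -> R) : (forall j, 1 <= c j) ->
  (forall j, 2 * (c j - 1) <= \sum_k (c k - 1)) -> realizable c.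
Proof.
case: n c => [|[|n]] c c1 c_le.
- by apply: realizable1; have := c_le ord0; have := c1 ord0; rewrite big_ord1; lra.
- have := c_le 0; have := c_le 1; rewrite !big_ord_recl !big_ord0 addr0.
  have -> : lift ord0 ord0 = 1 :> 'I_2 by apply/val_inj.
  by move=> h1 h0; apply: realizable2; rewrite ?c1 //; lra.
pose j1 := [arg max_(j > ord0) c j]%O.
have c_max j : c j <= c j1 by rewrite /j1; case: arg_maxP => // i _; apply.
set m := fun j => c j - 1.
have [] := @balanced_split _ [set~ j1] m (m j1).
- by rewrite cardsC1 card_ord.
- by move=> z _; rewrite /m lerD2r.
- by have := c_le j1; rewrite (bigD1 j1) //= (eq_bigl (mem [set~ j1])) => [|z];
    rewrite ?inE // /m; lra.
move=> A [AU /set0Pn[z1 z1A] /set0Pn[z2 z2A]].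
rewrite (big_setID A) /= (finset.setIidPr AU); set SA := \sum_(z in A) m z.
set SB := \sum_(z in _) m z; rewrite ler_norml => bal.
pose o0 := @Ordinal 3 0 isT; pose o1 := @Ordinal 3 1 isT.
pose o2 := @Ordinal 3 2 isT.
(* The three classes are the largest mode, [A] and the rest; [r] picks a representative of each. *)
pose g j := if j == j1 then o0 else if j \in A then o1 else o2.
pose r (h : 'I_3) := tnth [tuple j1; z1; z2] h.
have j1A : j1 \notin A by apply/negP => /(fintype.subsetP AU); rewrite !inE eqxx.
have AN z : z \in A -> (z == j1) = false.
  by move=> zA; apply/eqP => zj; rewrite -zj zA in j1A.
have rK : cancel r g.
  elim/ord3_ind; rewrite /r (tnth_nth j1) /= /g ?eqxx //.
    by rewrite AN ?z1A.
  by move: z2A; rewrite !inE => /andP[/negPf -> /negPf ->].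
have M0 : \sum_(j | g j == o0) (c j - 1) = m j1.
  rewrite (big_pred1 j1) // => j; rewrite /g /=.
  by have [//|_] := eqVneq j j1; case: ifP.
have M1 : \sum_(j | g j == o1) (c j - 1) = SA.
  apply: eq_bigl => j; rewrite /g; have [->|_] := eqVneq j j1.
    by rewrite (negPf j1A).
  by case: ifP.
have M2 : \sum_(j | g j == o2) (c j - 1) = SB.
  apply: eq_bigl => j; rewrite /g !inE; have [->|_] := eqVneq j j1.
    by rewrite andbF.
  by rewrite andbT; case: ifP.
apply: (realizable_merge rK c1); apply: realizable3.
  by move=> h; rewrite lerDl sumr_ge0 // => j _; rewrite subr_ge0.
have SA0 : 0 <= SA by rewrite sumr_ge0 // => j _; rewrite subr_ge0.
have SB0 : 0 <= SB by rewrite sumr_ge0 // => j _; rewrite subr_ge0.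
have mj1 : m j1 <= SA + SB.
  have := c_le j1; rewrite (bigD1 j1) //= (eq_bigl (mem [set~ j1])) => [|z].
    by rewrite (big_setID A) /= (finset.setIidPr AU) -/SA -/SB /m; lra.
  by rewrite !inE.
move: bal => /andP[bal1 bal2].
by elim/ord3_ind; rewrite sum_ord3 -/o0 -/o1 -/o2 M0 M1 M2; lra.
Qed.

End ManyModes.

(** * Equality of the two sets of entropy vectors *)

Local Open Scope classical_set_scope.

Theorem corollary4 (R : realType) (n : nat) (hn : (1 <= n)%N) :
  [set \row_(j < n) entanglement_entropy rho j
    | rho in [set rho : gaussian_state R n | pure rho]] =
  [set \row_(j < n) entropyf (c j)
    | c in [set c : 'I_n -> R | forall j : 'I_n,
              1 <= c j /\ c j - 1 <= \sum_(k < n | k != j) (c k - 1)]].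
Proof.
have entE (rho : gaussian_state R n) j : entanglement_entropy rho j =
    entropyf (Num.sqrt (\det (submxblock (cov rho) j j))).
  by rewrite /entanglement_entropy /vn_entropy symp_eigenvalue_reduced.
apply/seteqP; split=> [_ [rho prho <-]|_ [c hc <-]].
  exists (fun j => Num.sqrt (\det (submxblock (cov rho) j j))).
    by move=> j; exact: pure_marginals.
  by apply/rowP => j; rewrite !mxE entE.
have c1 j : 1 <= c j by case: (hc j).
have [L [K [LK LL KK]]] : realizable c.
  case: n c c1 hc hn {entE} => // n c c1 hc _.
  (* Adding [c j - 1] to both sides turns the condition into its form with the full sum. *)
  apply: polygon_realizable => // j; rewrite (bigD1 j) //=.
  by have [_] := hc j; lra.
have [|rho prho rhoE] := pure_of_pos_mom LK _ LL KK.
  by move=> j; apply: le_trans (c1 j).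
by exists rho => //; apply/rowP => j; rewrite !mxE entE rhoE.
Qed.
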